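(* Let $g:\mathbb{N}_0\to\mathbb{R}_+=[0,\infty)$ be a monotone function. Let $(G_n)_{n\ge 1}$ be a sequence of (possibly random, almost surely finite) graphs, each rooted at a uniformly chosen vertex $o_n$ of $G_n$, such that $(d_{o_n}g(d_{o_n}))_{n\ge 1}$ is uniformly integrable. Let $(G,o)$ be a random connected locally finite rooted graph with law $\mu$ such that $\mu(d_o\ge 1)>0$, and assume that $G_n$ converges locally in probability to $(G,o)$. Then $$\delta(G_n)\ \xrightarrow{\ \mathbb{P}\ }\ \frac{\mathbb{E}_\mu\big[d_o\,|g(d_o)-g(d_V)|\big]}{\mathbb{E}_\mu[d_o]}\qquad (n\to\infty),$$ where $V$ is a neighbour of $o$ in $G$ chosen uniformly at random.
   Context: Graphs are undirected; $d_v$ denotes the degree of vertex $v$. For a graph $G$, $\vec{E}(G)$ is the set of ordered pairs $(u,v)$ with $\{u,v\}\in E(G)$ (each undirected edge gives two directed edges), and $\sum_{u\to v}$ denotes summation over $(u,v)\in\vec{E}(G)$. Local convergence in probability: for a locally finite rooted graph $(G,o)$ and integer $r\ge 0$, $B_r^{(G)}(o)$ is the subgraph of $G$ induced by the vertices at graph distance at most $r$ from $o$, rooted at $o$; $\simeq$ denotes isomorphism of rooted graphs (a graph isomorphism mapping root to root). The sequence $G_n$ converges locally in probability to the random connected rooted graph $(G,o)$ with law $\mu$ if for every rooted graph $H_\star$ and every integer $r\ge 0$, $\frac{1}{|V(G_n)|}\sum_{v\in V(G_n)}\mathbf{1}_{\{B_r^{(G_n)}(v)\simeq H_\star\}}\to\mu(B_r^{(G)}(o)\simeq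 H_\star)$ in probability as $n\to\infty$. $\mathbb{E}_\mu$ is expectation over $(G,o)\sim\mu$ and over the uniform choice of the neighbour $V$. Uniform integrability is with respect to the joint randomness of $G_n$ and $o_n$. Degree-degree distance of a graph $G$ (with respect to the monotone function $g$): $$\delta(G)=\frac{1}{|\vec{E}(G)|}\sum_{u\to v}|g(d_u)-g(d_v)|.$$
   Formalization: ''Monotone'' is taken as nondecreasing: for nonincreasing g the claim can fail, e.g. g(k)=1/max(k,1) with G_n disjoint 3-vertex paths (n vertices) plus a clique on √n vertices, where the stated limit is 1/2 but δ(G_n)→2/7. *)

(* Defs.v *)
From HB Require Import structures.
From mathcomp Require Import all_boot all_order all_algebra finmap.
From mathcomp Require Import all_classical all_reals all_analysis.

Set Implicit Arguments.
Unset Strict Implicit.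
Unset Printing Implicit Defensive.

Import Order.TTheory GRing.Theory Num.Theory.
Import numFieldNormedType.Exports.

Local Open Scope classical_set_scope.
Local Open Scope ring_scope.

(* Simple undirected graphs, finite or infinite. Vertices are labelled by
   natural numbers: finite graphs, and connected locally finite graphs, have
   countably many vertices. *)
Record graph := Graph {
  vset : set nat;
  adj : rel nat;
  adj_sym : symmetric adj;
  adj_irr : irreflexive adj;
  adj_vset : forall u v, adj u v -> vset u }.

Definition nbrs (G : graph) (v : nat) : set nat := [set u | adj G v u].

(* [fset_set A] is empty when [A] is infinite, so [deg], [nverts] and [ndedges]
   are 0 in the infinite case. *)
Definition deg (G : graph) (v : nat) : nat := #|` fset_set (nbrs G v)|.

Definition nverts (G : graph) : nat := #|` fset_set (vset G)|.

Definition dedges (G : graph) : set (nat * nat) := [set e | adj G e.1 e.2].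

Definition ndedges (G : graph) : nat := #|` fset_set (dedges G)|.

Definition locally_finite (G : graph) : Prop :=
  forall v, vset G v -> finite_set (nbrs G v).

Definition dist_le (G : graph) (r : nat) (u v : nat) : Prop :=
  exists p : seq nat, [/\ path (adj G) u p, last u p = v & (size p <= r)%N].

Definition connected_graph (G : graph) : Prop :=
  forall u v, vset G u -> vset G v -> exists r, dist_le G r u v.

Section induced_subgraph.
Variables (G : graph) (A : set nat).

Definition induced_adj : rel nat :=
  fun u v => [&& `[< A u >], `[< A v >] & adj G u v].

Lemma induced_sym : symmetric induced_adj.
Proof. by move=> u v; rewrite /induced_adj adj_sym andbCA. Qed.

Lemma induced_irr : irreflexive induced_adj.
Proof. by move=> u; rewrite /induced_adj adj_irr !andbF. Qed.

Lemma induced_vset u v : induced_adj u v -> (vset G `&` A) u.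
Proof. by case/and3P => /asboolP Au _ /adj_vset Gu; split. Qed.

Definition induced : graph := Graph induced_sym induced_irr induced_vset.

End induced_subgraph.

Definition ball_graph (G : graph) (r : nat) (o : nat) : graph :=
  induced G [set v | dist_le G r o v].

Definition rooted_iso (G : graph) (o : nat) (H : graph) (h : nat) : Prop :=
  exists f : nat -> nat,
    [/\ set_bij (vset G) (vset H) f, f o = h &
      forall u v, vset G u -> vset G v -> adj H (f u) (f v) = adj G u v].

Definition ball_iso (G : graph) (r v : nat) (H : graph) (h : nat) : Prop :=
  rooted_iso (ball_graph G r v) v H h.

Definition degdeg_dist (R : realType) (g : nat -> R) (G : graph) : R :=
  (ndedges G)%:R^-1 *
  \sum_(e \in dedges G) `|g (deg G e.1) - g (deg G e.2)|.

(* Expectation of [F V] for [V] a uniformly chosen neighbour of [o];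
   0 if [o] has no neighbour. *)
Definition nbr_mean (R : realType) (G : graph) (o : nat) (F : nat -> R) : R :=
  (deg G o)%:R^-1 * \sum_(v \in nbrs G o) F v.

Definition ball_freq (R : realType) (G : graph) (r : nat) (H : graph)
    (h : nat) : R :=
  (nverts G)%:R^-1 * \sum_(v \in vset G) (\1_[set u | ball_iso G r u H h] v : R).

(* Measurability for the sigma-algebra on labelled graphs generated by the
   presence of each vertex and each edge. *)
Definition random_graph (d : measure_display) (T : measurableType d)
    (G : T -> graph) : Prop :=
  (forall v, measurable [set w | vset (G w) v]) /\
  (forall u v, measurable [set w | adj (G w) u v]).

(* For an almost surely finite random graph [G], the conditional law of [o]
   given [G] is uniform on the vertices of [G]. *)
Definition uniform_root (d : measure_display) (T : measurableType d)
    (R : realType) (P : probability T R) (G : T -> graph) (o : T -> nat)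
    : Prop :=
  [/\ forall v, measurable [set w | o w = v],
      {ae P, forall w, vset (G w) (o w)} &
      forall (H : graph) (v : nat), finite_set (vset H) -> vset H v ->
        P [set w | G w = H /\ o w = v] =
        (P [set w | G w = H] * ((nverts H)%:R^-1)%:E)%E].

(* Random elements of the space of connected locally finite rooted graphs up
   to isomorphism: the measurable sets of that space are generated by the
   isomorphism classes of the balls around the root. *)
Definition random_rooted_graph (d : measure_display) (S : measurableType d)
    (G : S -> graph) (o : S -> nat) : Prop :=
  (forall w, [/\ vset (G w) (o w), connected_graph (G w) &
                 locally_finite (G w)]) /\
  (forall (r : nat) (H : graph) (h : nat),
     measurable [set w | ball_iso (G w) r (o w) H h]).

(* The limit is an extended real: for an infinite [c] this is false. *)
Definition cvg_in_prob (R : realType) (d : nat -> measure_display)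
    (T : forall n, measurableType (d n)) (P : forall n, probability (T n) R)
    (Y : forall n, T n -> R) (c : \bar R) : Prop :=
  forall eps : R, 0 < eps ->
    (P n [set w | (eps%:E < `|(Y n w)%:E - c|)%E] @[n --> \oo] --> 0%E).

Definition uniformly_integrable (R : realType) (d : nat -> measure_display)
    (T : forall n, measurableType (d n)) (P : forall n, probability (T n) R)
    (X : forall n, T n -> R) : Prop :=
  (ereal_sup (range (fun n : nat =>
     (\int[P n]_(w in [set w | (K < `|X n w|)%R]) (`|X n w|)%:E)%E))
   @[K --> +oo%R] --> 0%E).

Definition local_cvg_in_prob (R : realType) (d : nat -> measure_display)
    (T : forall n, measurableType (d n)) (P : forall n, probability (T n) R)
    (Gn : forall n, T n -> graph)
    (d' : measure_display) (S : measurableType d') (mu : probability S R)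
    (G : S -> graph) (o : S -> nat) : Prop :=
  forall (H : graph) (h : nat) (r : nat), vset H h ->
    cvg_in_prob P (fun n w => ball_freq R (Gn n w) r H h)
      (mu [set w | ball_iso (G w) r (o w) H h]).

(* Main.v *)
(** Both sums in delta(G) are of the form sum_{u->v} phi(d_u, d_v), with
    phi = |g - g| and phi = 1, so dividing each by |V(G)| it suffices to show
    that the vertex mean of F(G, v) = sum_{u ~ v} phi(d_v, d_u) converges in
    probability to E_mu[F(G, o)] whenever phi(j, k) <= C g(max(j, k)) for large
    max(j, k). The functional F only depends on the ball of radius 2.

    For a nonnegative local functional, finitely many isomorphism classes of
    balls carry the mean up to any precision, so local convergence bounds the
    vertex mean from below by any c < E_mu F. The upper bound applies this to
    K M - F_K, where F_K <= K M is F with phi truncated to degrees at most K.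
    The truncation error is at most 2 C times the vertex mean of
    d_v g(d_v) 1{d_v > K}, whose expectation is
    E[d_{o_n} g(d_{o_n}) 1{d_{o_n} > K}], small uniformly in n by uniform
    integrability. *)

Require Import Defs.
From HB Require Import structures.
From mathcomp Require Import all_boot all_order all_algebra finmap.
From mathcomp Require Import all_classical all_reals all_analysis.
From mathcomp Require Import measurable_realfun lra.

Set Implicit Arguments.
Unset Strict Implicit.
Unset Printing Implicit Defensive.

Import Order.TTheory GRing.Theory Num.Theory.
Import numFieldNormedType.Exports.

Local Open Scope classical_set_scope.
Local Open Scope ring_scope.

(** * Graphs and rooted isomorphisms *)

(** The other fields are proofs, equal by proof irrelevance. Hence a finite graph is coded by two
    finite sets, and finite labelled graphs are countably many. *)
Lemma graph_eq (G H : graph) :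
  vset G = vset H -> dedges G = dedges H -> G = H.
Proof.
case: G H => [V e s i a] [V' e' s' i' a'] /= VV' /seteqP[ee' e'e].
have E : e = e'.
  apply/funext => u; apply/funext => v; apply/idP/idP.
    exact: (ee' (u, v)).
  exact: (e'e (u, v)).
by subst; congr Graph; exact: Prop_irrelevance.
Qed.

Definition fin_nonempty (G : graph) : Prop := finite_set (vset G) /\ vset G !=set0.

Lemma nbrs_vset (G : graph) (v : nat) : nbrs G v `<=` vset G.
Proof. by move=> u; rewrite /nbrs /= adj_sym => /adj_vset. Qed.

Lemma finite_nbrs (G : graph) (v : nat) :
  finite_set (vset G) -> finite_set (nbrs G v).
Proof. exact/sub_finite_set/nbrs_vset. Qed.

Lemma finite_graph_locally_finite (G : graph) :
  finite_set (vset G) -> locally_finite G.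
Proof. by move=> fG v _; exact: finite_nbrs. Qed.

Lemma dedges_sub (G : graph) : dedges G `<=` vset G `*` vset G.
Proof.
move=> [u v] uv; split; first exact: adj_vset uv.
exact: nbrs_vset uv.
Qed.

Lemma finite_dedges (G : graph) :
  finite_set (vset G) -> finite_set (dedges G).
Proof.
by move=> fG; apply: (sub_finite_set (@dedges_sub G)); exact: finite_setX.
Qed.

Lemma ltn0_nverts (G : graph) : fin_nonempty G -> (0 < nverts G)%N.
Proof.
move=> [fG [v Gv]]; rewrite /nverts cardfs_gt0; apply/fset0Pn; exists v.
by rewrite in_fset_set// inE.
Qed.

Lemma fset_set_infinite (T : choiceType) (A : set T) :
  ~ finite_set A -> fset_set A = fset0.
Proof. by rewrite /fset_set; case: pselect. Qed.

(* Summing ones gives the junk value 0 on infinite sets on both sides. *)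
Lemma deg_sum (G : graph) (v : nat) : deg G v = (\sum_(u \in nbrs G v) 1)%N.
Proof.
rewrite /deg; have [fN|iN] := pselect (finite_set (nbrs G v)).
  by rewrite fsbig_finite//= sum1_size.
rewrite fset_set_infinite// cardfs0 fsbig_dflt//.
by apply: contra_not iN; rewrite setIidl.
Qed.

Lemma deg_nbrs (G H : graph) (u v : nat) :
  nbrs G u = nbrs H v -> deg G u = deg H v.
Proof. by rewrite /deg => ->. Qed.

Section rooted_isomorphisms.

Lemma rooted_iso_sym (G H : graph) (o h : nat) :
  vset G o -> rooted_iso G o H h -> rooted_iso H h G o.
Proof.
move=> Go [f [[fGH finj fsurj] fo fadj]].
(* The inverse picks a preimage inside [vset G], because [f] is injective only there. Its default
   value 0 is taken only outside the image. *)
pose f' y := xget 0%N [set x | vset G x /\ f x = y].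
have f'P y : vset H y -> vset G (f' y) /\ f (f' y) = y.
  move=> /fsurj[x Gx fxy].
  by have : [set x | vset G x /\ f x = y] (f' y) by apply: xgetPex; exists x.
have f'K x : vset G x -> f' (f x) = x.
  move=> Gx; have [Gfx ffx] := f'P _ (fGH _ Gx).
  by apply: finj; rewrite ?inE.
exists f'; split; first split.
- by move=> y /f'P[].
- move=> y z; rewrite !inE => /f'P[_ fy] /f'P[_ fz] yz.
  by rewrite -fy -fz yz.
- by move=> x Gx; exists (f x); [exact: fGH|exact: f'K].
- by rewrite -fo f'K.
- move=> u v Hu Hv; have [Gu fu] := f'P _ Hu; have [Gv fv] := f'P _ Hv.
  by rewrite -(fadj _ _ Gu Gv) fu fv.
Qed.

Lemma rooted_iso_trans (G H K : graph) (o h k : nat) :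
  rooted_iso G o H h -> rooted_iso H h K k -> rooted_iso G o K k.
Proof.
move=> [f [bf fo fadj]] [f' [bf' f'h f'adj]]; exists (f' \o f); split.
- exact: set_bij_comp bf bf'.
- by rewrite /= fo.
- have [fGH _ _] := bf => u v Gu Gv /=.
  by rewrite f'adj ?fadj//; exact: fGH.
Qed.

Lemma rooted_iso_refl (G : graph) (o : nat) : rooted_iso G o G o.
Proof.
exists id; split => //.
by split => //; move=> x Gx; exists x.
Qed.

End rooted_isomorphisms.

(** The functional F(G, v): the degree for [phi] constant 1, the inner sum of the degree-degree
    distance for |g - g|. *)
Definition nbr_sum (R : realType) (phi : nat -> nat -> R) (G : graph)
  (v : nat) : R := \sum_(u \in nbrs G v) phi (deg G v) (deg G u).

Lemma iso_nbrs_bij (G H : graph) (f : nat -> nat) (u : nat) :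
  set_bij (vset G) (vset H) f ->
  (forall u v, vset G u -> vset G v -> adj H (f u) (f v) = adj G u v) ->
  vset G u -> set_bij (nbrs G u) (nbrs H (f u)) f.
Proof.
move=> [fGH finj fsurj] fadj Gu; split.
- by move=> v uv; rewrite /nbrs /= fadj//; exact: nbrs_vset uv.
- by move=> v w; rewrite !inE => /nbrs_vset Gv /nbrs_vset Gw; apply: finj;
    rewrite inE.
- move=> y Hy; have [v Gv vy] := fsurj _ (nbrs_vset Hy).
  by exists v => //; move: Hy; rewrite /nbrs /= -vy fadj.
Qed.

Lemma iso_deg (G H : graph) (f : nat -> nat) (u : nat) :
  set_bij (vset G) (vset H) f ->
  (forall u v, vset G u -> vset G v -> adj H (f u) (f v) = adj G u v) ->
  vset G u -> deg H (f u) = deg G u.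
Proof.
move=> bf fadj Gu; rewrite !deg_sum.
exact: (reindex_fsbig f _ _ _ (iso_nbrs_bij bf fadj Gu)).
Qed.

Lemma nbr_sum_iso (R : realType) (phi : nat -> nat -> R) (G H : graph)
    (o h : nat) :
  vset G o -> rooted_iso G o H h -> nbr_sum phi G o = nbr_sum phi H h.
Proof.
move=> Go [f [bf <- fadj]]; rewrite /nbr_sum.
rewrite [RHS](reindex_fsbig f _ _ _ (iso_nbrs_bij bf fadj Go)).
apply: eq_fsbigr => v; rewrite inE => /nbrs_vset Gv.
by rewrite !(iso_deg bf fadj).
Qed.

(** * Balls around the root *)

Lemma dist_le_refl (G : graph) (r v : nat) : dist_le G r v v.
Proof. by exists [::]. Qed.

Lemma ball_graph_root (G : graph) (r v : nat) :
  vset G v -> vset (ball_graph G r v) v.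
Proof. by move=> Gv; split => //; exact: dist_le_refl. Qed.

Lemma dist_le_adj (G : graph) (r o u v : nat) :
  dist_le G r o u -> adj G u v -> dist_le G r.+1 o v.
Proof.
move=> [p [pp lp sp]] uv; exists (rcons p v); split.
- by rewrite rcons_path pp lp.
- by rewrite last_rcons.
- by rewrite size_rcons.
Qed.

Lemma dist_leS (G : graph) (r o u : nat) : dist_le G r o u -> dist_le G r.+1 o u.
Proof. by move=> [p [pp lp sp]]; exists p; split => //; exact: leqW. Qed.

Lemma nbrs_ball_graph (G : graph) (r o u : nat) :
  dist_le G r o u -> nbrs (ball_graph G r.+1 o) u = nbrs G u.
Proof.
move=> ou; apply/seteqP; split => [v|v uv].
  by rewrite /nbrs /= => /and3P[].
rewrite /nbrs /=; apply/and3P; split => //; apply/asboolP.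
  exact: dist_leS.
exact: dist_le_adj uv.
Qed.

(** Radius 2 is needed to see every edge at a neighbour of the root, hence the degrees of the
    neighbours. *)
Lemma nbr_sum_ball_graph (R : realType) (phi : nat -> nat -> R) (G : graph)
  (o : nat) : nbr_sum phi (ball_graph G 2 o) o = nbr_sum phi G o.
Proof.
have oo : dist_le G 1 o o by exact: dist_le_refl.
rewrite /nbr_sum nbrs_ball_graph//; apply: eq_fsbigr => v; rewrite inE => ov.
congr phi; apply: deg_nbrs; apply: nbrs_ball_graph => //.
by apply: (dist_le_adj (u := o)) => //; exact: dist_le_refl.
Qed.

(** By induction on the radius: the last edge of a path of length at most r + 1 leaves a vertex of
    the ball of radius r, and each such vertex has finitely many neighbours. *)
Lemma finite_ball_graph (G : graph) (r o : nat) :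
  locally_finite G -> vset G o -> finite_set (vset (ball_graph G r o)).
Proof.
move=> lfG Go; suff : finite_set [set v | dist_le G r o v].
  by apply: sub_finite_set => v [].
elim: r => [|r IHr].
  apply: (sub_finite_set _ (finite_set1 o)) => v [p [_ <-]].
  by rewrite leqn0 size_eq0 => /eqP ->.
pose B := [set v | dist_le G r o v] `&` vset G.
apply: (@sub_finite_set _ _ (\bigcup_(u in B) nbrs G u `|` [set o])).
  move=> v [p]; case/lastP: p => [|p w] [].
    by move=> _ /= <- _; right.
  rewrite rcons_path last_rcons size_rcons ltnS => /andP[pp lw] wv sp.
  left; exists (last o p); last by rewrite /nbrs /= -wv.
  by split; [exists p|exact: adj_vset lw].
rewrite finite_setU; split; last exact: finite_set1.
apply: bigcup_finite; first by apply: (sub_finite_set _ IHr) => v [].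
by move=> u [_ Gu]; exact: lfG.
Qed.
(** * Sums over directed edges and vertex means *)

Lemma sum_dedges (R : realType) (G : graph) (F : nat -> nat -> R) :
  finite_set (vset G) ->
  \sum_(e \in dedges G) F e.1 e.2 =
  \sum_(v \in vset G) \sum_(u \in nbrs G v) F v u.
Proof.
move=> fG.
transitivity (\sum_(v \in vset G) \sum_(u \in vset G)
    if u \in nbrs G v then F v u else 0); last first.
  apply: eq_fsbigr => v _; rewrite -fsbig_mkcondr; apply: eq_fsbigl.
  by rewrite setIC setIidl//; exact: nbrs_vset.
rewrite pair_fsbig// -[in LHS](setIidr (@dedges_sub G)) fsbig_mkcondr.
by apply: eq_fsbigr => -[u v] _ /=.
Qed.

Lemma sum_dedges_swap (R : realType) (G : graph) (F : nat -> nat -> R) :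
  \sum_(e \in dedges G) F e.2 e.1 = \sum_(e \in dedges G) F e.1 e.2.
Proof.
rewrite [RHS](reindex_fsbig (fun e => (e.2, e.1)) (dedges G))//; split.
- by move=> [u v]; rewrite /dedges /= adj_sym.
- by move=> [u v] [u' v'] _ _ [-> ->].
- by move=> [u v] uv; exists (v, u) => //; move: uv; rewrite /dedges /= adj_sym.
Qed.

Lemma nbr_sum1 (R : realType) (G : graph) (v : nat) :
  nbr_sum (fun _ _ => 1 : R) G v = (deg G v)%:R :> R.
Proof.
rewrite /nbr_sum /deg; have [fN|iN] := pselect (finite_set (nbrs G v)).
  by rewrite fsbig_finite//= big_const_seq count_predT iter_addr_0.
rewrite fset_set_infinite// cardfs0 fsbig_dflt//.
apply: contra_not iN; rewrite setIidl// => u _ /=.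
by apply/eqP; rewrite oner_eq0.
Qed.

Lemma ndedges_sum (R : realType) (G : graph) : finite_set (vset G) ->
  (ndedges G)%:R = \sum_(v \in vset G) nbr_sum (fun _ _ => 1 : R) G v :> R.
Proof.
move=> fG; rewrite -(sum_dedges (fun _ _ => 1 : R) fG) fsbig_finite/=; last first.
  exact: finite_dedges.
by rewrite big_const_seq count_predT iter_addr_0.
Qed.

Definition vmean (R : realType) (f : graph -> nat -> R) (G : graph) : R :=
  (nverts G)%:R^-1 * \sum_(v \in vset G) f G v.

Lemma vmean_infinite (R : realType) (f : graph -> nat -> R) (G : graph) :
  ~ finite_set (vset G) -> vmean f G = 0.
Proof.
by move=> iG; rewrite /vmean /nverts fset_set_infinite// cardfs0 invr0 mul0r.
Qed.

(** The common factor 1/|V(G)| cancels. On an edgeless graph both sides are 0, the inverse of 0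
    being 0. *)
Lemma degdeg_dist_vmean (R : realType) (g : nat -> R) (G : graph) : fin_nonempty G ->
  degdeg_dist g G = vmean (nbr_sum (fun j k => `|g j - g k|)) G /
                    vmean (nbr_sum (fun _ _ => 1 : R)) G.
Proof.
move=> gG; have [fG _] := gG; have n0 : (nverts G)%:R != 0 :> R.
  by rewrite pnatr_eq0 -lt0n ltn0_nverts.
rewrite /degdeg_dist (sum_dedges (fun u v => `|g (deg G u) - g (deg G v)|) fG).
by rewrite /vmean -ndedges_sum// -mulf_div divff ?invr_eq0// mul1r mulrC.
Qed.

Section vertex_means.
Variables (R : realType) (G : graph).
Hypothesis fG : finite_set (vset G).

Lemma ler_fsum (I : choiceType) (A : set I) (f h : I -> R) :
  finite_set A -> (forall i, A i -> f i <= h i) ->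
  \sum_(i \in A) f i <= \sum_(i \in A) h i.
Proof.
move=> fA fh; rewrite !fsbig_finite//= big_seq [leRHS]big_seq.
by apply: ler_sum => i; rewrite in_fset_set// inE => /fh.
Qed.

Lemma vmean_le (f h : graph -> nat -> R) :
  (forall v, vset G v -> f G v <= h G v) -> vmean f G <= vmean h G.
Proof.
by move=> fh; rewrite /vmean ler_wpM2l ?invr_ge0//; exact: ler_fsum.
Qed.

Lemma vmeanZ (a : R) (f : graph -> nat -> R) :
  vmean (fun H v => a * f H v) G = a * vmean f G.
Proof. by rewrite /vmean -mulr_fsumr mulrCA. Qed.

Lemma vmeanD (f h : graph -> nat -> R) :
  vmean (fun H v => f H v + h H v) G = vmean f G + vmean h G.
Proof. by rewrite /vmean fsbig_split//= mulrDr. Qed.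

Lemma vmean_sum (n : nat) (f : nat -> graph -> nat -> R) :
  vmean (fun H v => \sum_(i < n) f i H v) G = \sum_(i < n) vmean (f i) G.
Proof.
rewrite /vmean fsbig_finite//= exchange_big/= mulr_sumr.
by apply: eq_bigr => i _; rewrite fsbig_finite.
Qed.

Lemma vmean_cst (a : R) : vset G !=set0 -> vmean (fun _ _ => a) G = a.
Proof.
move=> G0; have n0 : (nverts G)%:R != 0 :> R.
  by rewrite pnatr_eq0 -lt0n ltn0_nverts.
rewrite /vmean fsbig_finite//= big_const_seq count_predT iter_addr_0.
by rewrite -[X in _ * X]mulr_natl mulrA mulVf// mul1r.
Qed.

End vertex_means.

Definition below (R : realType) (K : nat) (phi : nat -> nat -> R) (j k : nat) :=
  if (maxn j k <= K)%N then phi j k else 0.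

(** At a uniform root this is the uniformly integrable variable cut down to degrees above [K]. *)
Definition deg_tail (R : realType) (g : nat -> R) (K : nat) (G : graph)
    (v : nat) : R :=
  if (K < deg G v)%N then (deg G v)%:R * g (deg G v) else 0.

(* An edge with an endpoint of degree larger than [K] is charged to the
   endpoint of larger degree. *)
Lemma vmean_below (R : realType) (g : nat -> R) (C : R) (K : nat)
    (phi : nat -> nat -> R) (G : graph) :
  finite_set (vset G) -> (forall k, 0 <= g k) -> 0 <= C ->
  (forall j k, (K < maxn j k)%N -> phi j k <= C * g (maxn j k)) ->
  vmean (nbr_sum phi) G <=
  vmean (nbr_sum (below K phi)) G + 2 * C * vmean (deg_tail g K) G.
Proof.
move=> fG g0 C0 phiC; rewrite /vmean [2 * C * _]mulrCA -mulrDr.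
rewrite ler_wpM2l ?invr_ge0//.
(* Spreading d g(d) evenly over the d edges leaving a vertex writes the tail as a sum of [gK] over
   directed edges. *)
pose gK j := if (K < j)%N then g j else 0.
have gK0 j : 0 <= gK j by rewrite /gK; case: ifP.
have -> : \sum_(v \in vset G) deg_tail g K G v =
    \sum_(e \in dedges G) gK (deg G e.1).
  rewrite (sum_dedges (fun u _ => gK (deg G u)) fG).
  apply: eq_fsbigr => v _; transitivity ((deg G v)%:R * gK (deg G v)).
    by rewrite /deg_tail /gK; case: ifP; rewrite ?mulr0.
  rewrite -nbr_sum1 /nbr_sum mulr_fsuml.
  by under eq_fsbigr do rewrite mul1r.
have fE := finite_dedges fG.
rewrite -!(sum_dedges (fun u v => _ (deg G u) (deg G v)) fG).
(* Reversing the edges replaces half of the sum by the degrees of the heads. This is the origin of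
   the factor 2. *)
have -> : 2 * C * \sum_(e \in dedges G) gK (deg G e.1) =
    \sum_(e \in dedges G) (C * (gK (deg G e.1) + gK (deg G e.2))).
  rewrite -mulr_fsumr fsbig_split//=.
  by rewrite (sum_dedges_swap _ (fun u _ => gK (deg G u))); lra.
rewrite -fsbig_split//=; apply: ler_fsum => // -[u v] _ /=.
rewrite /below; case: leqP => [_|Kmax].
  by rewrite lerDl mulr_ge0// addr_ge0.
rewrite add0r (le_trans (phiC _ _ Kmax))// ler_wpM2l//.
move: Kmax; rewrite /maxn; case: ifP => _ Kj; rewrite /gK Kj.
  by rewrite lerDr; exact: gK0.
by rewrite lerDl; exact: gK0.
Qed.

Lemma nbr_sum_ge0 (R : realType) (phi : nat -> nat -> R) (G : graph) (v : nat) :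
  (forall j k, 0 <= phi j k) -> 0 <= nbr_sum phi G v.
Proof. by move=> phi0; exact: fsumr_ge0. Qed.

Lemma nbr_sum_below_le (R : realType) (phi : nat -> nat -> R) (K : nat)
    (G : graph) (v : nat) : finite_set (nbrs G v) ->
  (forall j k, 0 <= phi j k) -> nbr_sum (below K phi) G v <= nbr_sum phi G v.
Proof.
move=> fN phi0; apply: ler_fsum => // u _; rewrite /below.
by case: ifP.
Qed.

(** A vertex of degree above [K] contributes only zero terms. Any other vertex has at most [K]
    terms, each at most [M]. *)
Lemma nbr_sum_below_bound (R : realType) (phi : nat -> nat -> R) (K : nat)
    (M : R) (G : graph) (v : nat) : finite_set (nbrs G v) -> 0 <= M ->
  (forall j k, (maxn j k <= K)%N -> phi j k <= M) ->
  nbr_sum (below K phi) G v <= K%:R * M.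
Proof.
move=> fN M0 phiM; have [dK|Kd] := leqP (deg G v) K; last first.
  rewrite /nbr_sum fsbig1 ?mulr_ge0// => u _; rewrite /below.
  by rewrite leqNgt (leq_trans Kd) ?leq_maxl.
apply: (@le_trans _ _ ((deg G v)%:R * M)); last by rewrite ler_wpM2r ?ler_nat.
rewrite -nbr_sum1 mulr_fsuml; apply: ler_fsum => // u _.
by rewrite mul1r /below; case: ifP => // /phiM.
Qed.
(** * Measurability of graph events *)

Section countable_events.
Context d (T : measurableType d).

Lemma bigcupC_measurable (C : countType) (F : C -> set T) :
  (forall c, measurable (F c)) -> measurable (\bigcup_c F c).
Proof. exact/countable_bigcupT_measurable/countableP. Qed.

Lemma bigcapC_measurable (C : countType) (F : C -> set T) :
  (forall c, measurable (F c)) -> measurable (\bigcap_c F c).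
Proof.
move=> mF; rewrite -[X in measurable X]setCK setC_bigcap; apply: measurableC.
by apply: bigcupC_measurable => c; exact: measurableC.
Qed.

Lemma measurable_prop (P : Prop) : measurable [set _ : T | P].
Proof.
have [p|np] := pselect P.
  by rewrite (_ : [set _ | _] = setT)//; apply/seteqP; split.
by rewrite (_ : [set _ | _] = set0)//; apply/seteqP; split.
Qed.

Section random_sets.
Variables (C : countType) (N : T -> set C).
Hypothesis mN : forall c, measurable [set w | N w c].

Lemma random_set_eq_measurable (A : set C) : measurable [set w | N w = A].
Proof.
rewrite (_ : [set w | _] =
    \bigcap_c if `[< A c >] then [set w | N w c] else ~` [set w | N w c]).
  by apply: bigcapC_measurable => c; case: ifP => // _; exact: measurableC.
apply/seteqP; split => [w /= NwA c _|w NA].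
  by case: asboolP => /= Ac; rewrite NwA.
apply/seteqP; split => c; have /= := NA c I; case: asboolP => //.
Qed.

(** The finite subsets of a countable type are countably many, so the finite values of [N] are
    handled one at a time. On infinite values [Q] has the constant truth value [b], which covers
    quantities with a default value there. *)
Lemma random_set_measurable (Q : set C -> Prop) (b : Prop) :
  (forall A, ~ finite_set A -> Q A <-> b) -> measurable [set w | Q (N w)].
Proof.
move=> Qb.
have mfin (Q' : set C -> Prop) :
    measurable [set w | finite_set (N w) /\ Q' (N w)].
  rewrite (_ : [set w | _] = \bigcup_(A : {fset C})
      ([set w | N w = [set` A]] `&` [set _ | Q' [set` A]])).
    apply: bigcupC_measurable => A; apply: measurableI.
      exact: random_set_eq_measurable.
    exact: measurable_prop.
  apply/seteqP; split => [w /= [/finite_fsetP[A NA] QA]|w [A _ [/= -> QA]]].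
    by exists A => //; split => //=; rewrite -NA.
  by split.
rewrite (_ : [set w | _] = [set w | finite_set (N w) /\ Q (N w)] `|`
    (~` [set w | finite_set (N w) /\ True] `&` [set _ | b])).
  apply: measurableU => //; apply: measurableI; last exact: measurable_prop.
  exact/measurableC/(mfin (fun=> True)).
apply/seteqP; split => [w /= QN|w /=].
  have [fN|iN] := pselect (finite_set (N w)); first by left.
  by right; split; [case|exact/(Qb _ iN)].
case=> [[]//|[iN bb]]; apply/Qb => // fN; exact: iN.
Qed.

End random_sets.

Section random_graphs.
Variable G : T -> graph.
Hypothesis mG : random_graph G.

(** The event is a countable union over codes of finite graphs, each code prescribing the vertex set
    and the edge set. *)
Lemma finite_graph_event_measurable (Q : graph -> Prop) :
  measurable [set w | finite_set (vset (G w)) /\ Q (G w)].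
Proof.
pose code (c : {fset nat} * {fset (nat * nat)}) H :=
  vset H = [set` c.1] /\ dedges H = [set` c.2].
rewrite (_ : [set w | _] = \bigcup_c
    ([set w | vset (G w) = [set` c.1]] `&` [set w | dedges (G w) = [set` c.2]]
     `&` [set _ | exists2 H, code c H & Q H])).
  have [mV mE] := mG.
  apply: (@bigcupC_measurable ({fset nat} * {fset (nat * nat)})%type) => c.
  apply: measurableI; last first.
    exact: measurable_prop.
  apply: measurableI; first exact: random_set_eq_measurable.
  by apply: (@random_set_eq_measurable _ (fun w => dedges (G w))) => -[u v];
    exact: mE.
apply/seteqP; split => [w /= [fG QG]|w [c _ [[/= GV GE] [H [HV HE] QH]]]].
  have fE := finite_dedges fG.
  exists (fset_set (vset (G w)), fset_set (dedges (G w))) => //=.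
  rewrite !fset_setK//; split => //; exists (G w) => //.
  by split; rewrite /= fset_setK.
rewrite /= GV; split => //.
by rewrite (_ : G w = H)//; apply: graph_eq; rewrite ?GV ?GE ?HV ?HE.
Qed.

Lemma fin_nonempty_event_measurable (Q : graph -> Prop) :
  measurable [set w | fin_nonempty (G w) /\ Q (G w)].
Proof.
rewrite (_ : [set w | _] = [set w | finite_set (vset (G w)) /\
    (vset (G w) !=set0 /\ Q (G w))]).
  exact: (finite_graph_event_measurable (fun H => vset H !=set0 /\ Q H)).
by apply/seteqP; split => w /= => [[[]]|[? []]].
Qed.

Lemma not_fin_nonempty_measurable : measurable [set w | ~ fin_nonempty (G w)].
Proof.
rewrite (_ : [set w | _] = ~` [set w | fin_nonempty (G w) /\ True]).
  exact/measurableC/(fin_nonempty_event_measurable (fun=> True)).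
by apply/seteqP; split => w /= ng => [[]|gG] //; apply: ng.
Qed.

Lemma graph_event_measurable (Q : graph -> Prop) (b : Prop) :
  (forall H, ~ finite_set (vset H) -> Q H <-> b) -> measurable [set w | Q (G w)].
Proof.
move=> Qb; rewrite (_ : [set w | _] =
    [set w | finite_set (vset (G w)) /\ Q (G w)] `|`
    (~` [set w | finite_set (vset (G w)) /\ True] `&` [set _ | b])).
  apply: measurableU; first exact: finite_graph_event_measurable.
  apply: measurableI; last exact: measurable_prop.
  exact/measurableC/(finite_graph_event_measurable (fun=> True)).
apply/seteqP; split => [w /= QG|w /=].
  have [fG|iG] := pselect (finite_set (vset (G w))); first by left.
  by right; split; [case|exact/(Qb _ iG)].
case=> [[]//|[iG bb]]; apply/Qb => // fG; exact: iG.
Qed.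

(** The edge set may be finite while the vertex set is infinite, so the argument runs on the random
    set of directed edges. It determines the distance, whose default is 0 when this set is
    infinite. *)
Lemma degdeg_dist_event_measurable (R : realType) (g : nat -> R)
  (A : R -> Prop) : measurable [set w | A (degdeg_dist g (G w))].
Proof.
pose dg (E : set (nat * nat)) v := #|` fset_set [set u | E (v, u)]|.
pose D (E : set (nat * nat)) := (#|` fset_set E|)%:R^-1 *
  \sum_(e \in E) `|g (dg E e.1) - g (dg E e.2)|.
apply: (@random_set_measurable _ (fun w => dedges (G w)) _
  (fun E => A (D E)) (A 0)) => [[u v]|E iE].
  by have [_] := mG; exact.
by rewrite /D fset_set_infinite// cardfs0 invr0 mul0r.
Qed.

Variable o : T -> nat.
Hypothesis mo : forall v, measurable [set w | o w = v].

Lemma root_event_measurable (Q : T -> nat -> Prop) :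
  (forall v, measurable [set w | Q w v]) -> measurable [set w | Q w (o w)].
Proof.
move=> mQ; rewrite (_ : [set w | _] =
    \bigcup_v ([set w | o w = v] `&` [set w | Q w v])).
  by apply: bigcupC_measurable => v; exact: measurableI.
apply/seteqP; split => [w /= Qw|w [v _ [/= ->//]]].
by exists (o w).
Qed.

Lemma deg_event_measurable (A : nat -> Prop) :
  measurable [set w | A (deg (G w) (o w))].
Proof.
apply: (@root_event_measurable (fun w v => A (deg (G w) v))) => v.
apply: (@random_set_measurable _ (fun w => nbrs (G w) v) _
  (fun N => A #|` fset_set N|) (A 0%N)) => [u|N iN].
  by have [_] := mG; exact.
by rewrite fset_set_infinite// cardfs0.
Qed.

End random_graphs.

End countable_events.

(** * Enumeration of finite rooted graphs up to isomorphism *)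

(** An element is listed at the number of its code, and [x0] fills the indices that code nothing. *)
Lemma enum_of_injection (X : Type) (C : countType) (P : X -> Prop)
    (code : X -> C) (x0 : X) : P x0 ->
  (forall x y, P x -> P y -> code x = code y -> x = y) ->
  exists e : nat -> X, (forall i, P (e i)) /\ forall x, P x -> exists i, e i = x.
Proof.
move=> Px0 inj.
pose e i := if pselect (exists x, P x /\ choice.pickle (code x) = i) is left h
  then projT1 (cid h) else x0.
exists e; split=> [i|x Px].
  by rewrite /e; case: pselect => //= h; case: (cid h) => x [].
exists (choice.pickle (code x)); rewrite /e; case: pselect => /= [h|[]].
  by case: (cid h) => y /= [Py xy]; apply: inj => //; exact: (pcan_inj choice.pickleK).
by exists x.
Qed.

Lemma singleton_graph : exists G : graph, vset G = [set 0%N].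
Proof.
pose e : rel nat := fun _ _ => false.
have es : symmetric e by [].
have ei : irreflexive e by [].
have ev (u v : nat) : e u v -> [set 0%N] u by [].
by exists (Graph es ei ev).
Qed.

(** All finite rooted graphs are enumerated, and [J] keeps the least index of each isomorphism
    class, so that every finite rooted graph matches exactly one index of [J]. *)
Lemma rooted_iso_classes : exists (H : nat -> graph) (h : nat -> nat)
    (J : set nat), (forall i, vset (H i) (h i)) /\
  forall B v, finite_set (vset B) -> vset B v ->
    exists i, [/\ J i, rooted_iso B v (H i) (h i) &
      forall j, J j -> rooted_iso B v (H j) (h j) -> j = i].
Proof.
pose P (x : graph * nat) := finite_set (vset x.1) /\ vset x.1 x.2.
pose code (x : graph * nat) :=
  (fset_set (vset x.1), fset_set (dedges x.1), x.2).
have [G0 G0E] := singleton_graph.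
have [||e [Pe esurj]] := @enum_of_injection _ _ P code (G0, 0%N).
- by split; rewrite /= G0E.
- move=> [G v] [H w] [/= fG Gv] [/= fH Hw] [+ + ->].
  move=> /(fset_set_inj fG fH) GH.
  move=> /(fset_set_inj (finite_dedges fG) (finite_dedges fH)) GHE.
  by rewrite (graph_eq GH GHE).
pose H i := (e i).1; pose h i := (e i).2.
pose iso i j := `[< rooted_iso (H i) (h i) (H j) (h j) >].
exists H, h, [set i | forall j, iso i j -> (i <= j)%N].
split=> [i|B v fB Bv]; first by have [] := Pe i.
have ex : exists i, `[< rooted_iso B v (H i) (h i) >].
  have [|i ei] := esurj (B, v) => //.
  by exists i; apply/asboolP; rewrite /H /h ei; exact: rooted_iso_refl.
case: (ex_minnP ex) => i /asboolP Bi imin; exists i; split => //.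
  move=> j /asboolP ij; apply: imin; apply/asboolP.
  exact: rooted_iso_trans Bi ij.
move=> j Jj Bj; apply/eqP; rewrite eqn_leq imin ?andbT; last exact/asboolP.
apply: Jj; apply/asboolP/(rooted_iso_trans _ Bi).
exact: rooted_iso_sym.
Qed.
(** * Functionals of the ball around the root *)

(** A real upper bound makes a nonnegative extended real finite, so the criterion for real limits
    applies. *)
Lemma cvge0P (R : realType) (I : Type) (F : set_system I) (FF : Filter F)
    (u : I -> \bar R) : (forall i, (0 <= u i)%E) ->
  (u @ F --> 0%E) <-> (forall e : R, 0 < e -> \forall i \near F, (u i <= e%:E)%E).
Proof.
move=> u0; have fine_le e i : (u i <= e%:E)%E -> u i \is a fin_num.
  by move=> ue; rewrite ge0_fin_numE// (le_lt_trans ue) ?ltry.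
split=> [/fine_cvgP[fu /cvgrPdist_le cu] e e0|H].
  apply: filterS2 fu (cu e e0) => i fui; rewrite sub0r normrN => ue.
  by rewrite -(fineK fui) lee_fin (le_trans (ler_norm _)).
apply/fine_cvgP; split.
  by apply: filterS (H 1 ltr01) => i; exact: fine_le.
apply/cvgrPdist_le => e e0; apply: filterS (H e e0) => i ue.
rewrite sub0r normrN /= ger0_norm ?fine_ge0//.
by rewrite -lee_fin fineK//; exact: fine_le ue.
Qed.

(** The representative [H] stands for the ball itself, so the value is also computed on the ball
    with everything outside it removed. *)
Definition local_functional (X : Type) (r : nat) (f : graph -> nat -> X) :=
  forall G v H h, vset G v -> ball_iso G r v H h -> f G v = f H h.

Lemma nbr_sum_local (R : realType) (phi : nat -> nat -> R) :
  local_functional 2 (nbr_sum phi).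
Proof.
move=> G v H h Gv GH; rewrite -nbr_sum_ball_graph.
exact: nbr_sum_iso (ball_graph_root _ Gv) GH.
Qed.

Section local_limit.
Context (R : realType) (d' : measure_display) (S : measurableType d').
Variables (mu : probability S R) (G : S -> graph) (o : S -> nat).
Hypothesis Go : random_rooted_graph G o.

(** The ball has countably many isomorphism classes and [f] is constant on each, so the event is a
    countable union of ball events. *)
Lemma local_event_measurable (X : Type) (r : nat) (f : graph -> nat -> X)
    (Q : X -> Prop) :
  local_functional r f -> measurable [set w | Q (f (G w) (o w))].
Proof.
move=> lf; have [H [h [J [Hh HJ]]]] := rooted_iso_classes.
have [lfG mG] := Go.
rewrite (_ : [set w | _] = \bigcup_i ([set w | ball_iso (G w) r (o w) (H i) (h i)]
    `&` [set _ | Q (f (H i) (h i))])).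
  apply: bigcup_measurable => i _; apply: measurableI; first exact: mG.
  exact: measurable_prop.
apply/seteqP; split => [w /= Qf|w [i _ [/= GH]]]; have [ow _ lfw] := lfG w.
  have [i [_ Gi _]] := HJ _ _ (finite_ball_graph r lfw ow) (ball_graph_root r ow).
  by exists i => //; split => //=; rewrite -(lf _ _ _ _ ow Gi).
by rewrite (lf _ _ _ _ ow GH).
Qed.

Lemma local_measurable_fun (r : nat) (f : graph -> nat -> R) :
  local_functional r f -> measurable_fun setT (fun w => (f (G w) (o w))%:E).
Proof.
move=> lf _ Y mY; rewrite setTI.
exact: (local_event_measurable (fun y => Y y%:E) lf).
Qed.

(* The ball of radius [r] takes countably many values up to isomorphism, and
   finitely many of them carry the mean of [f] up to an arbitrary precision. *)
Lemma local_mean_approx (r : nat) (f : graph -> nat -> R) (c : R) :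
  local_functional r f ->
  (forall H v, finite_set (vset H) -> 0 <= f H v) ->
  (c%:E < \int[mu]_w (f (G w) (o w))%:E)%E ->
  exists (H : nat -> graph) (h : nat -> nat) (a : nat -> R) (N : nat),
    [/\ forall i, vset (H i) (h i), forall i, 0 <= a i,
      forall K v, locally_finite K -> vset K v ->
        \sum_(i < N) a i * \1_[set u | ball_iso K r u (H i) (h i)] v <= f K v &
      c <= \sum_(i < N)
        a i * fine (mu [set w | ball_iso (G w) r (o w) (H i) (h i)])].
Proof.
move=> lf f0 clt; have [H [h [J [Hh HJ]]]] := rooted_iso_classes.
have [lfG mG] := Go.
have HJG K v : locally_finite K -> vset K v -> exists i,
    [/\ J i, ball_iso K r v (H i) (h i) &
      forall j, J j -> ball_iso K r v (H j) (h j) -> j = i].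
  by move=> lfK Kv; exact: HJ (finite_ball_graph r lfK Kv) (ball_graph_root r Kv).
have fi_ge0 K v : locally_finite K -> vset K v -> 0 <= f K v.
  move=> lfK Kv; have bb : ball_iso K r v (ball_graph K r v) v.
    exact: rooted_iso_refl.
  by rewrite (lf _ _ _ _ Kv bb) f0//; exact: finite_ball_graph.
(* The coefficient is the value of [f] on the class. It is 0 off [J], so that no class counts twice,
   and 0 where [f] is negative, which cannot happen on a class met by a ball. *)
pose a i := if `[< J i /\ 0 <= f (H i) (h i) >] then f (H i) (h i) else 0.
pose E i := [set w | ball_iso (G w) r (o w) (H i) (h i)].
pose F i := if `[< J i >] then E i else set0.
have mE i : measurable (E i) by exact: mG.
have mF i : measurable (F i) by rewrite /F; case: ifP.
have a0 i : 0 <= a i by rewrite /a; case: asboolP => // -[].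
have FT : \bigcup_i F i = setT.
  apply/seteqP; split => // w _; have [ow _ lfw] := lfG w.
  have [i [Ji Gi _]] := HJG _ _ lfw ow.
  by exists i => //; rewrite /F; case: asboolP.
have tF : trivIset setT F.
  move=> i j _ _ [w []]; rewrite /F; case: asboolP => // Ji Gi.
  case: asboolP => // Jj Gj; have [ow _ lfw] := lfG w.
  have [k [_ _ ku]] := HJG _ _ lfw ow.
  by rewrite (ku i)// (ku j).
have intF i : (\int[mu]_(w in F i) (f (G w) (o w))%:E = (a i)%:E * mu (E i))%E.
  rewrite /F; case: asboolP => Ji; last first.
    by rewrite integral_set0 /a; case: asboolP => [[]//|_]; rewrite mul0e.
  rewrite -(integral_cst mu (mE i)); apply: eq_integral => w.
  rewrite inE => Ew; have [ow _ lfw] := lfG w.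
  have fE := lf _ _ _ _ ow Ew.
  rewrite /a; case: asboolP => [_|]; first by rewrite fE.
  by case; split => //; rewrite -fE fi_ge0.
move: clt; rewrite -FT ge0_integral_bigcup//; last first.
  - by move=> w _; have [ow _ lfw] := lfG w; rewrite lee_fin fi_ge0.
  - by rewrite FT; exact: local_measurable_fun lf.
under eq_eseriesr do rewrite intF.
have aE0 i : (0 <= (a i)%:E * mu (E i))%E by rewrite mule_ge0 ?lee_fin.
(* The mean of [f] is a series of nonnegative terms with sum above [c], so some partial sum reaches
   [c]. *)
move=> /lte_lim[||N _ /(_ N (leqnn N))].
- exact: lee_sum_nneg_natr.
- exact: is_cvg_nneseries.
move=> cN; exists H, h, a, N; split => //.
- move=> K v lfK Kv; have [i [Ji Ki iu]] := HJG K v lfK Kv.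
  have aK j : j != i -> a j * \1_[set u | ball_iso K r u (H j) (h j)] v = 0.
    move=> ji; rewrite /a; case: asboolP => [[Jj _]|]; last by rewrite mul0r.
    rewrite indicE memNset ?mulr0//= => Kj.
    by move/eqP: ji; apply; exact: iu.
  have aKi : a i * \1_[set u | ball_iso K r u (H i) (h i)] v <= f K v.
    rewrite indicE mem_set// mulr1 (lf _ _ _ _ Kv Ki) /a.
    by case: asboolP => // -[]; split => //; rewrite -(lf _ _ _ _ Kv Ki) fi_ge0.
  (* Only the index [i] of the class of the ball can contribute. If it is beyond [N], the sum is
     0. *)
  have [iN|Ni] := ltnP i N.
    rewrite (bigD1 (Ordinal iN))//= big1 ?addr0// => j jN.
    by apply: aK; apply: contra jN => /eqP ji; apply/eqP/val_inj.
  rewrite big1 ?fi_ge0// => j _; apply: aK.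
  by rewrite neq_ltn (leq_trans (ltn_ord j)).
- rewrite -lee_fin (le_trans cN)// big_mkord -sumEFin lee_sum// => i _.
  by rewrite EFinM fineK// fin_num_measure.
Qed.

End local_limit.
(** * Uniformly rooted finite random graphs *)

Section uniform_roots.
Context (R : realType) (d : measure_display) (T : measurableType d).
Variables (P : probability T R) (G : T -> graph) (o : T -> nat).
Hypothesis mG : random_graph G.
Hypothesis oG : uniform_root P G o.

(** The root almost surely lies in the graph, which is therefore nonempty. *)
Lemma fin_nonempty_ae : {ae P, forall w, finite_set (vset (G w))} ->
  P [set w | ~ fin_nonempty (G w)] = 0%E.
Proof.
move=> fG; have [_ ae_o _] := oG; apply: measure_negligible.
  exact: not_fin_nonempty_measurable.
have : {ae P, forall w, fin_nonempty (G w)}.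
  by apply: filterS2 fG ae_o => w fGw Gow; split => //; exists (o w).
by apply: negligibleS => w.
Qed.

(* For a deterministic graph [H] the event [G = H] splits according to the
   position of the root, and each vertex of [H] receives the same share. *)
Lemma uniform_root_mean_le (h : graph -> nat -> R) (H : graph) :
  (forall K v, 0 <= h K v) ->
  measurable_fun setT (fun w => (h (G w) (o w))%:E) -> fin_nonempty H ->
  ((vmean h H)%:E * P [set w | G w = H] <=
    \int[P]_(w in [set w | G w = H]) (h (G w) (o w))%:E)%E.
Proof.
move=> h0 mh gH; have [fH _] := gH; have [mo _ oP] := oG.
have mGH : measurable [set w | G w = H].
  rewrite (_ : [set w | _] = [set w | fin_nonempty (G w) /\ G w = H]).
    exact: (fin_nonempty_event_measurable mG (fun K => K = H)).
  by apply/seteqP; split => w /= => [->|[]].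
pose F v := [set w | G w = H /\ o w = v].
have mF v : measurable (F v) by exact: (measurableI _ _ mGH (mo v)).
have mU s : measurable (\big[setU/set0]_(v <- s) F v).
  by apply: bigsetU_measurable.
apply: (@le_trans _ _
    (\int[P]_(w in \big[setU/set0]_(v <- fset_set (vset H)) F v)
      (h (G w) (o w))%:E)%E); last first.
  apply: ge0_subset_integral => //.
  - exact: measurable_funTS.
  - by move=> w _; rewrite lee_fin.
  - by rewrite bigsetU_fset_set// => w [v _ []].
rewrite ge0_integral_bigsetU//=; last 3 first.
- by move=> u v _ _ [w [[_ <-] [_ <-]]].
- exact: measurable_funTS.
- by move=> w _; rewrite lee_fin.
rewrite (eq_big_seq (fun v => ((nverts H)%:R^-1 * h H v)%:E *
    P [set w | G w = H])%E); last first.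
  move=> v; rewrite in_fset_set// inE => Hv.
  transitivity (\int[P]_(w in F v) (cst (h H v)%:E w))%E.
    by apply: eq_integral => w; rewrite inE => -[-> ->].
  transitivity ((h H v)%:E * P (F v))%E; first exact: integral_cst.
  by rewrite /F (oP _ _ fH Hv) mulrC EFinM muleA muleAC.
rewrite -ge0_sume_distrl; last first.
  by move=> v _; rewrite lee_fin mulr_ge0// invr_ge0.
by rewrite sumEFin -mulr_sumr /vmean fsbig_finite.
Qed.

(** Markov's inequality for the vertex mean, which is the conditional expectation of [h] at the root
    given the graph. The event splits into the countably many events that fix a finite graph. *)
Lemma uniform_root_markov (h : graph -> nat -> R) (t : R) :
  (forall K v, 0 <= h K v) ->
  measurable_fun setT (fun w => (h (G w) (o w))%:E) -> 0 <= t ->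
  (t%:E * P [set w | fin_nonempty (G w) /\ (t <= vmean h (G w))%R] <=
    \int[P]_w (h (G w) (o w))%:E)%E.
Proof.
move=> h0 mh t0.
pose code K := choice.pickle (fset_set (vset K), fset_set (dedges K)).
pose A i := [set w | fin_nonempty (G w) /\ (t <= vmean h (G w) /\ code (G w) = i)].
have mA i : measurable (A i).
  exact: (fin_nonempty_event_measurable mG (fun K => t <= vmean h K /\ code K = i)).
have -> : [set w | fin_nonempty (G w) /\ t <= vmean h (G w)] = \bigcup_i A i.
  apply/seteqP; split => [w /= [gG tG]|w [i _ [gG [tG _]]]] //.
  by exists (code (G w)).
have tA : trivIset setT A by move=> i j _ _ [w [[_ [_ <-]] [_ [_ <-]]]].
have mU : measurable (\bigcup_i A i) by exact: bigcup_measurable.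
apply: (@le_trans _ _ (\int[P]_(w in \bigcup_i A i) (h (G w) (o w))%:E)%E).
  rewrite -integral_cst// !ge0_integral_bigcup//; last 2 first.
  - exact: measurable_funTS.
  - by move=> w _; rewrite lee_fin.
  apply: lee_nneseries => [i _ _|i _].
    by apply: integral_ge0 => w _; rewrite lee_fin.
  (* The code is injective on finite graphs, so a nonempty [A i] fixes the graph completely. *)
  have [->|/set0P[w0 [[fG0 nG0] [tG0 cG0]]]] := eqVneq (A i) set0.
    by rewrite !integral_set0.
  have -> : A i = [set w | G w = G w0].
    apply/seteqP; split => w /=; last by move=> wE; rewrite /A /= wE.
    move=> [[fG _] [_]]; rewrite -cG0 => /(pcan_inj choice.pickleK) [].
    move=> /(fset_set_inj fG fG0) VE.
    move=> /(fset_set_inj (finite_dedges fG) (finite_dedges fG0)).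
    exact: graph_eq.
  have mG0 : measurable [set w | G w = G w0].
    rewrite (_ : [set w | _] = [set w | fin_nonempty (G w) /\ G w = G w0]).
      exact: (fin_nonempty_event_measurable mG (fun K => K = G w0)).
    by apply/seteqP; split => w /= => [->|[]].
  rewrite integral_cst//; apply: le_trans (uniform_root_mean_le h0 mh _) => //.
  by rewrite lee_wpmul2r// lee_fin.
by apply: ge0_subset_integral => // w _; rewrite lee_fin.
Qed.

(** A degree above [K] forces d g(d) above [K1], so the mean of the tail at the root is at most the
    integral controlled by uniform integrability. Markov's inequality concludes. *)
Lemma deg_tail_markov (g : nat -> R) (K : nat) (K1 t eta : R) :
  (forall k, 0 <= g k) -> 0 < t ->
  (forall k, (K < k)%N -> K1 < k%:R * g k) ->
  (\int[P]_(w in [set w | (K1 < `|(deg (G w) (o w))%:R * g (deg (G w) (o w))|)%R])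
     (`|(deg (G w) (o w))%:R * g (deg (G w) (o w))|)%:E <= (t * eta)%:E)%E ->
  (P [set w | fin_nonempty (G w) /\ (t <= vmean (deg_tail g K) (G w))%R] <= eta%:E)%E.
Proof.
move=> g0 t0 gK intX; have [mo _ _] := oG.
pose X w := (deg (G w) (o w))%:R * g (deg (G w) (o w)).
have mD (A : nat -> Prop) := deg_event_measurable mG mo A.
have mX : measurable_fun setT (fun w => (`|X w|)%:E).
  by move=> _ Y mY; rewrite setTI; exact: (mD (fun k => Y (`|k%:R * g k|)%:E)).
have X0 w : 0 <= X w by rewrite /X mulr_ge0.
have mB : measurable [set w | K1 < `|X w|].
  exact: (mD (fun k => K1 < `|k%:R * g k|)).
have mC : measurable [set w | (K < deg (G w) (o w))%N].
  exact: (mD (fun k => (K < k)%N)).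
have dt0 H v : 0 <= deg_tail g K H v.
  by rewrite /deg_tail; case: ifP => // _; exact: mulr_ge0.
have mt : measurable_fun setT (fun w => (deg_tail g K (G w) (o w))%:E).
  move=> _ Y mY; rewrite setTI.
  exact: (mD (fun k => Y (if (K < k)%N then k%:R * g k else 0)%:E)).
rewrite -(@lee_pmul2l _ t%:E)// ?lte_fin// -EFinM.
apply: (le_trans (uniform_root_markov dt0 mt (ltW t0))).
apply: le_trans intX.
rewrite (_ : (\int[P]_w _)%E =
    (\int[P]_(w in [set w | (K < deg (G w) (o w))%N]) (`|X w|)%:E)%E).
  apply: ge0_subset_integral => //; first exact: measurable_funTS.
  by move=> w /= /gK; rewrite ger0_norm// mulr_ge0.
rewrite [RHS]integral_mkcond; apply: eq_integral => w _.
rewrite /patch /deg_tail; case: ifPn => Kw.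
  by rewrite mem_set// ger0_norm.
by rewrite memNset//=; exact/negP.
Qed.

End uniform_roots.
(** * Events of vanishing probability *)

Section vanishing_events.
Context (R : realType) (d : nat -> measure_display).
Context (T : forall n, measurableType (d n)).
Variables (P : forall n, probability (T n) R) (Gn : forall n, T n -> graph).
Arguments Gn : clear implicits.
Hypothesis Gn_random : forall n, random_graph (Gn n).

(** Restricting to finite nonempty graphs makes the event measurable for every [Q]. *)
Definition vanishing (Q : graph -> Prop) : Prop := forall eta : R, 0 < eta ->
  \forall n \near \oo,
    (P n [set w | fin_nonempty (Gn n w) /\ Q (Gn n w)] <= eta%:E)%E.

Lemma fin_nonempty_event_cover (n : nat) (Q Q1 Q2 : graph -> Prop) :
  (forall K, fin_nonempty K -> Q K -> Q1 K \/ Q2 K) ->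
  (P n [set w | fin_nonempty (Gn n w) /\ Q (Gn n w)] <=
   P n [set w | fin_nonempty (Gn n w) /\ Q1 (Gn n w)] +
   P n [set w | fin_nonempty (Gn n w) /\ Q2 (Gn n w)])%E.
Proof.
move=> Q12; have m := fin_nonempty_event_measurable (Gn_random n).
apply: le_trans (measureU2 (P n) (m Q1) (m Q2)).
apply: le_measure; rewrite ?inE; [exact: m|exact: measurableU|].
by move=> w /= [gG /(Q12 _ gG)[]]; [left|right].
Qed.

(** This is how a truncation enters: the level may depend on [eta], and the truncation error [Q2] is
    unlikely uniformly in [n]. *)
Lemma vanishing_approx (Q : graph -> Prop) :
  (forall eta : R, 0 < eta -> exists Q1 Q2 : graph -> Prop,
    [/\ vanishing Q1, forall n,
      (P n [set w | fin_nonempty (Gn n w) /\ Q2 (Gn n w)] <= eta%:E)%E &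
      forall K, fin_nonempty K -> Q K -> Q1 K \/ Q2 K]) -> vanishing Q.
Proof.
move=> H eta eta0; have e0 : 0 < eta / 2 by rewrite divr_gt0.
have [Q1 [Q2 [Q1v Q2e QQ]]] := H _ e0.
apply: filterS (Q1v _ e0) => n Q1n.
apply: le_trans (fin_nonempty_event_cover n QQ) _.
by rewrite [eta in leRHS]splitr EFinD; exact: leeD.
Qed.

Lemma vanishing_or (Q1 Q2 : graph -> Prop) :
  vanishing Q1 -> vanishing Q2 -> vanishing (fun K => Q1 K \/ Q2 K).
Proof.
move=> v1 v2 eta eta0; have e0 : 0 < eta / 2 by rewrite divr_gt0.
apply: filterS2 (v1 _ e0) (v2 _ e0) => n Q1n Q2n.
apply: (le_trans (@fin_nonempty_event_cover n _ Q1 Q2 (fun _ _ => id))).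
by rewrite [eta in leRHS]splitr EFinD; exact: leeD.
Qed.

Lemma vanishing_sub (Q Q' : graph -> Prop) :
  (forall K, fin_nonempty K -> Q K -> Q' K) -> vanishing Q' -> vanishing Q.
Proof.
move=> QQ' v eta eta0; apply: filterS (v _ eta0) => n; apply: le_trans.
have m := fin_nonempty_event_measurable (Gn_random n).
apply: le_measure; rewrite ?inE; [exact: m|exact: m|].
by move=> w /= [gG /(QQ' _ gG)].
Qed.

Lemma vanishing_ex (N : nat) (Q : nat -> graph -> Prop) :
  (forall i, vanishing (Q i)) ->
  vanishing (fun K => exists2 i, (i < N)%N & Q i K).
Proof.
move=> vQ; elim: N => [|N IHN].
  move=> eta eta0; apply: nearW => n.
  rewrite (_ : [set w | _] = set0) ?measure0 ?lee_fin ?ltW//.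
  by apply/seteqP; split => w //= [_ []].
refine (vanishing_sub _ (vanishing_or IHN (vQ N))) => K _ [i].
rewrite ltnS leq_eqVlt => /predU1P[->|iN] QK; first by right.
by left; exists i.
Qed.

(** The default value 0 of [Y] on infinite graphs makes the deviation event measurable, so
    monotonicity of the probability applies. *)
Lemma cvg_in_prob_vanishing (Y : graph -> R) (c eps : R) :
  (forall K, ~ finite_set (vset K) -> Y K = 0) ->
  cvg_in_prob P (fun n w => Y (Gn n w)) c%:E -> 0 < eps ->
  vanishing (fun K => eps < `|Y K - c|).
Proof.
move=> Y0 Yc eps0 eta eta0.
have /cvge0P/(_ eta eta0) := Yc eps eps0.
move=> /(_ (fun=> measure_ge0 _ _)); apply: filterS => n; apply: le_trans.
apply: le_measure; rewrite ?inE.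
- exact: (fin_nonempty_event_measurable (Gn_random n) (fun K => eps < `|Y K - c|)).
- apply: (graph_event_measurable (Gn_random n)
    (Q := fun K => (eps%:E < `|(Y K)%:E - c%:E|)%E)
    (b := (eps%:E < `|0%:E - c%:E|)%E)) => K iK.
  by rewrite Y0.
- by move=> w /= [_]; rewrite lte_fin.
Qed.

Lemma vanishing_degdeg_dist (g : nat -> R) (c : R) :
  (forall n, P n [set w | ~ fin_nonempty (Gn n w)] = 0%E) ->
  (forall eps : R, 0 < eps ->
    vanishing (fun K => eps < `|degdeg_dist g K - c|)) ->
  cvg_in_prob P (fun n w => degdeg_dist g (Gn n w)) c%:E.
Proof.
move=> bad0 vg eps eps0; apply/cvge0P => // eta eta0.
apply: filterS (vg _ eps0 _ eta0) => n; apply: le_trans.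
have m := fin_nonempty_event_measurable (Gn_random n).
have mng := not_fin_nonempty_measurable (Gn_random n).
have mQ := m (fun K => eps < `|degdeg_dist g K - c|).
rewrite -(measureU0 mQ mng (bad0 n)).
apply: le_measure; rewrite ?inE.
- exact: (degdeg_dist_event_measurable (Gn_random n) g
    (fun x => (eps%:E < `|x%:E - c%:E|)%E)).
- exact: measurableU.
- move=> w /=; rewrite lte_fin => epsg.
  by have [gG|ngG] := pselect (fin_nonempty (Gn n w)); [left|right].
Qed.

Section local_convergence.
Context (d' : measure_display) (S : measurableType d').
Variables (mu : probability S R) (G : S -> graph) (o : S -> nat).
Hypothesis Go_random : random_rooted_graph G o.
Hypothesis Gn_cvg : local_cvg_in_prob P Gn mu G o.

(** The finite combination of ball indicators lies below [f] at every vertex. Its vertex mean is a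
    combination of ball frequencies, each of which converges in probability. The integral may be
    infinite here. *)
Lemma local_mean_lower (r : nat) (f : graph -> nat -> R) (c : R) :
  local_functional r f ->
  (forall H v, finite_set (vset H) -> 0 <= f H v) ->
  (c%:E < \int[mu]_w (f (G w) (o w))%:E)%E ->
  vanishing (fun K => vmean f K < c).
Proof.
move=> lf f0 cf.
have [c' [cc' c'f]] : exists c', c < c' /\
    (c'%:E < \int[mu]_w (f (G w) (o w))%:E)%E.
  move: cf; case: (\int[mu]_w _)%E => [x||] //.
    rewrite lte_fin => cx; exists ((c + x) / 2).
    by rewrite lte_fin; split; lra.
  by move=> _; exists (c + 1); rewrite ltry; split => //; lra.
have [H [h [a [N [Hh a0 aK ca]]]]] := local_mean_approx Go_random lf f0 c'f.
pose q i K := ball_freq R K r (H i) (h i).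
pose p i := fine (mu [set w | ball_iso (G w) r (o w) (H i) (h i)]).
pose s := \sum_(i < N) a i.
have s0 : 0 <= s by exact: sumr_ge0.
(* An error [delta] in every frequency costs at most [delta * s], which fits into the gap between
   [c] and [c']. The denominator [1 + s] is positive even if [s] is 0. *)
have delta0 : 0 < (c' - c) / (1 + s) by apply: divr_gt0; lra.
have deltas : (c' - c) / (1 + s) * s <= c' - c.
  rewrite mulrAC ler_pdivrMr; last lra.
  by rewrite ler_wpM2l// ?subr_ge0 ?ltW// ltrDr.
set delta := (c' - c) / (1 + s) in delta0 deltas.
have vq i : vanishing (fun K => delta < `|q i K - p i|).
  apply: cvg_in_prob_vanishing => //.
    move=> K; exact: (@vmean_infinite _
      (fun K v => \1_[set u | ball_iso K r u (H i) (h i)] v)).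
  have [_ mG] := Go_random; rewrite fineK ?fin_num_measure//.
  exact: Gn_cvg.
refine (vanishing_sub _ (vanishing_ex N vq)) => K [fK _] Kc.
apply: contrapT => nq; move: Kc; apply/negP; rewrite -leNgt.
have qp i : (i < N)%N -> p i - delta <= q i K.
  move=> iN; have : `|q i K - p i| <= delta.
    by rewrite leNgt; apply/negP => qi; apply: nq; exists i.
  by rewrite ler_norml => /andP[+ _]; lra.
apply: (@le_trans _ _ (\sum_(i < N) a i * q i K)).
  have : \sum_(i < N) a i * (p i - delta) <= \sum_(i < N) a i * q i K.
    by apply: ler_sum => i _; rewrite ler_wpM2l// qp.
  apply: le_trans; under eq_bigr do rewrite mulrBr.
  rewrite sumrB -mulr_suml -/s.
  have {}ca : c' <= \sum_(i < N) a i * p i by [].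
  by move: ca deltas; rewrite (mulrC s); lra.
pose F i K v := a i * \1_[set u | ball_iso K r u (H i) (h i)] v.
have -> : \sum_(i < N) a i * q i K =
    vmean (fun K v => \sum_(i < N) F i K v) K.
  by rewrite vmean_sum//; apply: eq_bigr => i _; rewrite vmeanZ.
apply: vmean_le => // v Kv; apply: aK => //.
exact: finite_graph_locally_finite.
Qed.

End local_convergence.

End vanishing_events.
(** * Convergence of vertex means of edge functionals *)

Section edge_functionals.
Context (R : realType) (d : nat -> measure_display).
Context (T : forall n, measurableType (d n)).
Variables (P : forall n, probability (T n) R).
Variables (Gn : forall n, T n -> graph) (on : forall n, T n -> nat).
Arguments Gn : clear implicits.
Arguments on : clear implicits.
Hypothesis Gn_random : forall n, random_graph (Gn n).
Hypothesis on_unif : forall n, uniform_root (P n) (Gn n) (on n).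
Hypothesis Gn_bad : forall n, P n [set w | ~ fin_nonempty (Gn n w)] = 0%E.
Context (d' : measure_display) (S : measurableType d').
Variables (mu : probability S R) (G : S -> graph) (o : S -> nat).
Hypothesis Go_random : random_rooted_graph G o.
Hypothesis Gn_cvg : local_cvg_in_prob P Gn mu G o.
Variables (g : nat -> R) (K0 : nat).
Hypothesis g_ge0 : forall k, 0 <= g k.
Hypothesis g_mono : forall j k, (j <= k)%N -> g j <= g k.
Hypothesis gK0 : 0 < g K0.
Hypothesis Gn_ui : uniformly_integrable P (fun n w =>
  (deg (Gn n w) (on n w))%:R * g (deg (Gn n w) (on n w))).

(** Since [g] is monotone and positive at [K0], k g(k) exceeds any level once k is large, so a tail
    in the degree is a tail of the uniformly integrable variable. *)
Lemma deg_tail_small (K1 : nat) (t eta : R) : 0 < t -> 0 < eta ->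
  exists2 K, (K1 <= K)%N & forall n,
    (P n [set w | fin_nonempty (Gn n w) /\ (t <= vmean (deg_tail g K) (Gn n w))%R]
      <= eta%:E)%E.
Proof.
move=> t0 eta0; have te0 : 0 < t * eta by exact: mulr_gt0.
have := Gn_ui => /cvge0P => /(_ _)/(_ _ te0)[].
  move=> L; apply: le_trans (ereal_sup_ubound _); last by exists 0%N.
  exact: integral_ge0.
(* The bound holds strictly above [L0]. Positivity of [L] serves the Archimedean bound below. *)
move=> L0 [_ HL]; pose L := Num.max 1 (L0 + 1).
have L_gt0 : 0 < L by rewrite /L lt_max ltr01.
have {}HL : (ereal_sup (range (fun n =>
     (\int[P n]_(w in [set w |
        (L < `|(deg (Gn n w) (on n w))%:R * g (deg (Gn n w) (on n w))|)%R])
     (`|(deg (Gn n w) (on n w))%:R * g (deg (Gn n w) (on n w))|)%:E)%E))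
   <= (t * eta)%:E)%E.
  by apply: HL; rewrite /L lt_max ltrDl ltr01 orbT.
pose N := Num.bound (L / g K0).
have LN : L < N%:R * g K0.
  rewrite -ltr_pdivrMr//; apply: archi_boundP.
  by rewrite divr_ge0// ltW.
exists (maxn K1 (maxn K0 N)); first exact: leq_maxl.
move=> n; apply: (deg_tail_markov (Gn_random n) (on_unif n) (K1 := L)) => //.
  move=> k; rewrite !gtn_max => /and3P[_ K0k Nk].
  apply: (lt_le_trans LN); apply: ler_pM => //.
  - by rewrite ler_nat ltnW.
  - exact/g_mono/ltnW.
by apply: le_trans HL; apply: ereal_sup_ubound; exists n.
Qed.

Variables (phi : nat -> nat -> R) (B : nat -> R) (C : R).
Hypothesis phi_ge0 : forall j k, 0 <= phi j k.
Hypothesis phi_bound : forall K j k, (maxn j k <= K)%N -> phi j k <= B K.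
Hypothesis C_ge0 : 0 <= C.
Hypothesis phi_C : forall j k, (K0 < maxn j k)%N -> phi j k <= C * g (maxn j k).

Let B_ge0 K : 0 <= B K.
Proof. by apply: le_trans (phi_ge0 0 0) _; apply: phi_bound. Qed.

Let below_ge0 K j k : 0 <= below K phi j k.
Proof. by rewrite /below; case: ifP. Qed.

Let below_le K H v : finite_set (nbrs H v) ->
  nbr_sum (below K phi) H v <= K%:R * B K.
Proof. by move=> fN; apply: nbr_sum_below_bound => // j k; exact: phi_bound. Qed.

Let vmean_le_below K H : (K0 <= K)%N -> fin_nonempty H ->
  vmean (nbr_sum phi) H <=
  vmean (nbr_sum (below K phi)) H + 2 * C * vmean (deg_tail g K) H.
Proof.
move=> K0K [fH _]; apply: vmean_below => // j k Kjk.
by apply: phi_C; exact: leq_ltn_trans Kjk.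
Qed.

Let vmean_below_le K H : fin_nonempty H -> vmean (nbr_sum (below K phi)) H <= K%:R * B K.
Proof.
move=> [fH nH]; rewrite -(vmean_cst fH (K%:R * B K) nH).
by apply: vmean_le => // v _; apply: below_le; exact: finite_nbrs.
Qed.

(** Were the integral above [c], the vertex mean would be at least [c] with probability at least 3/4
    for some [n]. With probability at least 3/4 the tail mean is below 1, which forces the vertex
    mean below [c]. *)
Lemma nbr_sum_integral_fin :
  (\int[mu]_w (nbr_sum phi (G w) (o w))%:E < +oo)%E.
Proof.
have e0 : 0 < 4^-1 :> R by rewrite invr_gt0.
have [K K0K HK] := deg_tail_small K0 ltr01 e0.
(* The terms bound the truncated part and the error for a tail mean below 1; the last 1 makes the
   inequality strict. *)
pose c := K%:R * B K + 2 * C + 1.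
apply: le_lt_trans (ltry c); rewrite leNgt; apply/negP => cint.
have H0 H v : finite_set (vset H) -> 0 <= nbr_sum phi H v.
  by move=> _; exact: nbr_sum_ge0.
have [n _ Hn] := local_mean_lower Gn_random Go_random Gn_cvg
  (@nbr_sum_local _ phi) H0 cint e0.
have cover H : fin_nonempty H -> True ->
    vmean (nbr_sum phi) H < c \/ 1 <= vmean (deg_tail g K) H.
  move=> gH _; have [|d1] := leP 1 (vmean (deg_tail g K) H); first by right.
  left; apply: (le_lt_trans (vmean_le_below K0K gH)).
  have := vmean_below_le K gH; have : 2 * C * vmean (deg_tail g K) H <= 2 * C.
    by rewrite ler_piMr ?mulr_ge0// ltW.
  by rewrite /c; move=> h1 h2; lra.
have := fin_nonempty_event_cover P Gn_random n cover.
have m := fin_nonempty_event_measurable (Gn_random n).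
have -> : P n [set w | fin_nonempty (Gn n w) /\ True] = 1%E.
  rewrite -(probability_setT (P n)) -(measureU0 (m (fun=> True)) _ (Gn_bad n)).
    congr (P n _); apply/seteqP; split => w // _.
    by have [gG|ngG] := pselect (fin_nonempty (Gn n w)); [left|right].
  exact: not_fin_nonempty_measurable.
move=> /le_trans/(_ (leeD (Hn n (leqnn n)) (HK n))).
rewrite -EFinD lee_fin.
have -> : 4^-1 + 4^-1 = 2^-1 :> R by lra.
by apply/negP; rewrite -ltNge invf_lt1 ?ltr1n.
Qed.

Lemma nbr_sum_vanishing : exists a : R,
  (\int[mu]_w (nbr_sum phi (G w) (o w))%:E)%E = a%:E /\
  forall eps, 0 < eps ->
    vanishing P Gn (fun H => eps < `|vmean (nbr_sum phi) H - a|).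
Proof.
have phi0 H v : 0 <= nbr_sum phi H v by exact: nbr_sum_ge0.
set I := (\int[mu]_w (nbr_sum phi (G w) (o w))%:E)%E.
have I0 : (0 <= I)%E by apply: integral_ge0 => w _; rewrite lee_fin.
have fI : I \is a fin_num by rewrite ge0_fin_numE// nbr_sum_integral_fin.
exists (fine I); rewrite fineK//; split => // eps eps0.
set a := fine I; have Ia : I = a%:E by rewrite fineK.
have lower : vanishing P Gn (fun H => vmean (nbr_sum phi) H < a - eps).
  apply: (local_mean_lower Gn_random Go_random Gn_cvg (@nbr_sum_local _ phi)).
    by move=> H v _.
  by rewrite -/I Ia lte_fin ltrBlDr ltrDl.
have upper : vanishing P Gn (fun H => a + eps < vmean (nbr_sum phi) H).
  apply: (vanishing_approx Gn_random) => eta eta0.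
  have C0 : 0 < 2 * (2 * C + 1) by move: C_ge0; lra.
  (* The threshold makes the truncation error [2 * C * t] at most [eps / 2], and the added 1 covers
     [C] equal to 0. *)
  have t0 : 0 < eps / (2 * (2 * C + 1)) by rewrite divr_gt0.
  set t := eps / _ in t0.
  have Ct : 2 * C * t <= eps / 2.
    have : t * (2 * (2 * C + 1)) = eps by rewrite divfK// gt_eqF.
    by move: C_ge0 t0; nra.
  have [K K0K HK] := deg_tail_small K0 t0 eta0.
  pose M := K%:R * B K.
  pose f H v := M - nbr_sum (below K phi) H v.
  exists (fun H => vmean f H < M - a - eps / 2),
    (fun H => t <= vmean (deg_tail g K) H); split => //.
    have lbelow := @nbr_sum_local _ (below K phi).
    have lf : local_functional 2 f.
      by move=> H v H' v' Hv HH'; rewrite /f (lbelow _ _ _ _ Hv HH').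
    have f0 H v : finite_set (vset H) -> 0 <= f H v.
      by move=> fH; rewrite subr_ge0 below_le//; exact: finite_nbrs.
    apply: (local_mean_lower Gn_random Go_random Gn_cvg lf f0).
    have fN w : finite_set (nbrs (G w) (o w)).
      by have [/(_ w)[ow _ lfw] _] := Go_random; exact: lfw.
    pose J := (\int[mu]_w (nbr_sum (below K phi) (G w) (o w))%:E)%E.
    have mbelow := local_measurable_fun Go_random lbelow.
    have mf := local_measurable_fun Go_random lf.
    have mphi := local_measurable_fun Go_random (@nbr_sum_local _ phi).
    (* With [sumM], this puts the integral of [f] at [M - a] or above, hence strictly above
       [M - a - eps / 2]. *)
    have JI : (J <= a%:E)%E.
      rewrite -Ia; apply: ge0_le_integral => //.
      - by move=> w _; rewrite lee_fin nbr_sum_ge0.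
      - by move=> w _; rewrite lee_fin nbr_sum_below_le.
    have sumM : (\int[mu]_w (f (G w) (o w))%:E + J = M%:E)%E.
      rewrite -ge0_integralD//.
      - rewrite -[RHS]mule1 -(probability_setT mu) -integral_cst//.
        by apply: eq_integral => w _; rewrite -EFinD subrK.
      - by move=> w _; rewrite lee_fin subr_ge0 below_le.
      - by move=> w _; rewrite lee_fin nbr_sum_ge0.
    rewrite ltNge; apply/negP => fle.
    have := leeD fle JI; rewrite sumM -EFinD lee_fin.
    by move: eps0; lra.
  (* If the tail mean is below [t], truncation loses at most [eps / 2], so an excess of [eps] over
     [a] leaves the truncated mean above [a + eps / 2]. *)
  move=> H gH Hlt; have [|dt] := leP t (vmean (deg_tail g K) H); first by right.
  left; have [fH nH] := gH.
  have -> : vmean f H = M - vmean (nbr_sum (below K phi)) H.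
    apply/eqP; rewrite eq_sym subr_eq -(vmeanD fH); apply/eqP.
    rewrite -[LHS](vmean_cst fH _ nH); congr (_ * _).
    by apply: eq_fsbigr => v _; rewrite subrK.
  have := vmean_le_below K0K gH.
  have : 2 * C * vmean (deg_tail g K) H <= 2 * C * t.
    by rewrite ler_wpM2l ?mulr_ge0// ltW.
  by move: Ct Hlt; lra.
refine (vanishing_sub Gn_random _ (vanishing_or Gn_random lower upper)) => H _.
by rewrite ltr_normr => /orP[] ?; [right|left]; lra.
Qed.

End edge_functionals.

(** * Quotient of the two limits *)

(** The degree cancels the normalisation of the uniform neighbour. At degree 0 both sides are empty
    sums. *)
Lemma nbr_mean_scaled (R : realType) (G : graph) (o : nat) (F : nat -> R) :
  finite_set (nbrs G o) ->
  nbr_mean G o (fun V => (deg G o)%:R * F V) = \sum_(V \in nbrs G o) F V.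
Proof.
move=> fN; rewrite /nbr_mean -mulr_fsumr mulrA.
have [d0|d0] := eqVneq (deg G o) 0%N; last by rewrite mulVf ?mul1r// pnatr_eq0.
have N0 : nbrs G o = set0 by apply: fset_set_set0 => //; exact: cardfs0_eq.
by rewrite N0 fsbig_set0 mulr0.
Qed.

Lemma ratio_close (R : realType) (a b eps : R) : 0 <= a -> 0 < b -> 0 < eps ->
  exists2 eta, 0 < eta & forall x y, `|x - a| <= eta -> `|y - b| <= eta ->
    `|x / y - a / b| <= eps.
Proof.
move=> a0 b0 eps0; have ab0 : 0 < 2 * (a + b) by lra.
(* The first bound keeps [y] above [b / 2]. The second makes the numerator of the difference at most
   [eps * b ^+ 2 / 2], hence at most [eps * (y * b)]. *)
pose eta := Num.min (b / 2) (eps * b ^+ 2 / (2 * (a + b))).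
exists eta => [|x y].
  by rewrite /eta lt_min !divr_gt0// mulr_gt0// exprn_gt0.
rewrite /eta => xa; rewrite le_min => /andP[yb /[dup] yb2].
move: xa; rewrite le_min => /andP[_ xa] _.
have y0 : b / 2 <= y by move: yb; rewrite ler_norml => /andP[]; lra.
have yp : 0 < y by lra.
have -> : x / y - a / b = ((x - a) * b - a * (y - b)) / (y * b).
  rewrite -mulNr addf_div ?gt_eqF//; congr (_ / _); lra.
rewrite normrM normfV (gtr0_norm (mulr_gt0 yp b0)) ler_pdivrMr ?mulr_gt0//.
apply: (le_trans (ler_normB _ _)); rewrite !normrM (gtr0_norm b0) (ger0_norm a0).
have h : eps * b ^+ 2 / (2 * (a + b)) * (a + b) = eps * b ^+ 2 / 2.
  have s0 : a + b != 0 by rewrite gt_eqF//; lra.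
  by rewrite invfM -!mulrA mulVf// mulr1.
set e := eps * b ^+ 2 / _ in h xa yb2.
apply: (@le_trans _ _ (e * b + a * e)).
  by rewrite lerD// ?ler_wpM2r ?ler_wpM2l// ltW.
have -> : e * b + a * e = e * (a + b) by lra.
rewrite h expr2 -!mulrA (ler_wpM2l (ltW eps0))//.
by rewrite (mulrC y) ler_wpM2l// ltW.
Qed.

Theorem theorem2p5 (R : realType) (g : nat -> R)
  (g_ge0 : forall k : nat, 0 <= g k)
  (g_mono : forall j k : nat, (j <= k)%N -> g j <= g k)
  (d : nat -> measure_display) (T : forall n, measurableType (d n))
  (P : forall n, probability (T n) R)
  (Gn : forall n, T n -> graph) (on : forall n, T n -> nat)
  (Gn_random : forall n, random_graph (Gn n))
  (Gn_finite : forall n, {ae P n, forall w, finite_set (vset (Gn n w))})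
  (on_unif : forall n, uniform_root (P n) (Gn n) (on n))
  (Gn_ui : uniformly_integrable P (fun n w =>
     (deg (Gn n w) (on n w))%:R * g (deg (Gn n w) (on n w))))
  (d' : measure_display) (S : measurableType d') (mu : probability S R)
  (G : S -> graph) (o : S -> nat)
  (Go_random : random_rooted_graph G o)
  (Go_deg : (0 < mu [set w | (1 <= deg (G w) (o w))%N])%E)
  (Gn_cvg : local_cvg_in_prob P Gn mu G o) :
  cvg_in_prob P (fun n w => degdeg_dist g (Gn n w))
    ('E_mu[fun w => nbr_mean (G w) (o w) (fun V : nat =>
         ((deg (G w) (o w))%:R *
          `|g (deg (G w) (o w)) - g (deg (G w) V)|)%R)] /
     'E_mu[fun w => ((deg (G w) (o w))%:R)%R])%E.
Proof.
have Gn_bad n := fin_nonempty_ae (Gn_random n) (on_unif n) (Gn_finite n).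
have fN w : finite_set (nbrs (G w) (o w)).
  by have [/(_ w)[ow _ lfw] _] := Go_random; exact: lfw.
pose phi j k := `|g j - g k|.
pose one (j k : nat) : R := 1.
have -> : ('E_mu[fun w => nbr_mean (G w) (o w) (fun V : nat =>
    ((deg (G w) (o w))%:R * `|g (deg (G w) (o w)) - g (deg (G w) V)|)%R)] =
    \int[mu]_w (nbr_sum phi (G w) (o w))%:E)%E.
  rewrite unlock; apply: eq_integral => w _.
  by rewrite (nbr_mean_scaled (fun V => phi (deg (G w) (o w)) (deg (G w) V))).
have -> : ('E_mu[fun w => ((deg (G w) (o w))%:R)%R] =
    \int[mu]_w (nbr_sum one (G w) (o w))%:E)%E.
  by rewrite unlock; apply: eq_integral => w _; rewrite nbr_sum1.
(* If [g] vanishes identically, uniform integrability says nothing about the degrees and E_mu[d_o]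
   may be infinite. Then the distance and the numerator are 0, and so is the quotient in the
   extended reals. *)
have [[K0 gK0]|gN] := pselect (exists k, 0 < g k); last first.
  have g0 k : g k = 0.
    by apply/eqP; rewrite eq_le g_ge0 leNgt andbT; apply/negP => gk; apply: gN;
      exists k.
  have phi0 j k : phi j k = 0 by rewrite /phi !g0 subrr normr0.
  rewrite (_ : (\int[mu]_w (nbr_sum phi (G w) (o w))%:E)%E = 0%E); last first.
    by apply: integral0_eq => w _; rewrite /nbr_sum fsbig1.
  rewrite mul0e; apply: vanishing_degdeg_dist => // eps eps0 eta eta0.
  apply: nearW => n; rewrite (_ : [set w | _] = set0).
    by rewrite measure0 lee_fin ltW.
  apply/seteqP; split => // w /= [_].
  rewrite /degdeg_dist fsbig1 => [|e _]; last exact: phi0.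
  by rewrite mulr0 subrr normr0 ltNge ltW.
have phi_le j k : phi j k <= g (maxn j k).
  rewrite /phi; case: (leqP j k) => jk.
    rewrite ler0_norm ?subr_le0 ?g_mono// opprB.
    by rewrite lerBlDr lerDl.
  rewrite ger0_norm ?subr_ge0 ?g_mono ?(ltnW jk)//.
  by rewrite lerBlDr lerDl.
have cvg_sum := nbr_sum_vanishing Gn_random on_unif Gn_bad Go_random Gn_cvg
  g_ge0 g_mono gK0 Gn_ui.
have [a [Ia va]] : exists a : R,
    (\int[mu]_w (nbr_sum phi (G w) (o w))%:E)%E = a%:E /\
    forall eps, 0 < eps ->
      vanishing P Gn (fun H => eps < `|vmean (nbr_sum phi) H - a|).
  apply: (cvg_sum phi g 1) => //.
  - by move=> j k; exact: normr_ge0.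
  - by move=> K j k jk; apply: (le_trans (phi_le j k)); exact: g_mono.
  - by move=> j k _; rewrite mul1r.
have [b [Ib vb]] : exists b : R,
    (\int[mu]_w (nbr_sum one (G w) (o w))%:E)%E = b%:E /\
    forall eps, 0 < eps ->
      vanishing P Gn (fun H => eps < `|vmean (nbr_sum one) H - b|).
  (* Beyond [K0], monotonicity gives g(max(j, k)) / g(K0) at least 1, so the constant 1 is dominated
     with C = 1 / g(K0). *)
  apply: (cvg_sum one (fun=> 1) (g K0)^-1) => //.
  - by rewrite invr_ge0.
  - move=> j k K0jk; rewrite /one -(mulVf (lt0r_neq0 gK0)).
    by rewrite ler_wpM2l ?invr_ge0// g_mono// ltnW.
have a0 : 0 <= a.
  rewrite -lee_fin -Ia integral_ge0// => w _; rewrite lee_fin nbr_sum_ge0//.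
  by move=> j k; exact: normr_ge0.
(* The degree is a natural number, so it dominates the indicator of being at least 1, whose mean is
   positive by assumption. *)
have b0 : 0 < b.
  rewrite -lte_fin -Ib; apply: (lt_le_trans Go_deg).
  have mone := local_measurable_fun Go_random (@nbr_sum_local _ one).
  have mD : measurable [set w | (1 <= deg (G w) (o w))%N].
    rewrite (_ : [set w | _] = [set w | 1 <= nbr_sum one (G w) (o w)]).
      exact: (local_event_measurable Go_random (fun x => 1 <= x)
        (@nbr_sum_local _ one)).
    by apply/seteqP; split => w /=; rewrite nbr_sum1 ler1n.
  have one0 w : 0 <= nbr_sum one (G w) (o w) by exact: nbr_sum_ge0.
  rewrite -[leLHS]mul1e -integral_cst//.
  apply: (@le_trans _ _ (\int[mu]_(w in [set w | (1 <= deg (G w) (o w))%N])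
      (nbr_sum one (G w) (o w))%:E)%E).
    apply: ge0_le_integral => //; first exact: measurable_funTS.
    by move=> w /= dw; rewrite lee_fin nbr_sum1 ler1n.
  by apply: ge0_subset_integral => // w _; rewrite lee_fin.
rewrite Ia Ib inver gt_eqF// -EFinM.
apply: vanishing_degdeg_dist => // eps eps0.
have [eta eta0 Heta] := ratio_close a0 b0 eps0.
refine (vanishing_sub Gn_random _
  (vanishing_or Gn_random (va _ eta0) (vb _ eta0))) => H gH.
rewrite (degdeg_dist_vmean _ gH) => epsH.
have [xa|] := leP (`|vmean (nbr_sum phi) H - a|) eta; last by left.
have [yb|] := leP (`|vmean (nbr_sum one) H - b|) eta; last by right.
by move: epsH; rewrite ltNge Heta.
Qed.
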